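(* Let $\Sigma\subset\mathbb{R}^3$ be a compact, connected SS-surface. Then $\Sigma$ is a sphere.
   Context: Let $\Sigma\subset\mathbb{R}^3$ be a (regular, boundaryless) surface oriented by a unit normal $N$, with nowhere zero Gaussian curvature. For a local parametrization $X$ the Weingarten matrix $W$ is defined by $N_{,i}=\sum_jW_{ij}X_{,j}$ (subscripts denote partial derivatives), and $H=-\frac12\operatorname{tr}W$, $K=\det W$ are the mean and Gaussian curvatures. Let $\psi(p)=\langle p,N(p)\rangle$ (support function) and $\Lambda(p)=\langle p,p\rangle$ (quadratic distance function). $\Sigma$ is a surface of spherical type via support function (SS-surface) if for each $p\in\Sigma$ the sphere with center $p+\left(\frac{H(p)}{K(p)}+\frac{\psi(p)}{2}\right)N(p)$ and radius $\frac{H(p)}{K(p)}+\frac{\psi(p)}{2}$ passes through the origin; that is, $2\psi H+(\Lambda+\psi^2)K=0$ on $\Sigma$. *)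

(* Defs.v *)
From HB Require Import structures.
From mathcomp Require Import all_boot all_order all_algebra.
From mathcomp Require Import all_classical all_reals all_analysis.
From mathcomp Require Import ring.

Set Implicit Arguments.
Unset Strict Implicit.
Unset Printing Implicit Defensive.

Import Order.TTheory GRing.Theory Num.Theory.
Import numFieldNormedType.Exports.

Local Open Scope classical_set_scope.
Local Open Scope ring_scope.

(* The library norm and distance on 'rV[R]_n are those of the sup norm: they
   are used for the topology only, and Euclidean notions go through [dot]. *)
Definition dot (R : realType) n (p q : 'rV[R]_n) : R :=
  \sum_(i < n) p 0 i * q 0 i.

(* No sign condition on [r], only [r ^+ 2] matters: the radius of the spheres
   attached to an SS-surface may be negative for a given orientation. *)
Definition sphere (R : realType) n (c : 'rV[R]_n) (r : R) : set 'rV[R]_n :=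
  [set p | dot (p - c) (p - c) = r ^+ 2].

Definition partial (R : realType) m n (i : 'I_m) (f : 'rV[R]_m -> 'rV[R]_n) :
    'rV[R]_m -> 'rV[R]_n :=
  fun x => 'D_(delta_mx 0 i) f x.

(* Meant for an open set [U], where it says that [f] is infinitely
   differentiable on [U]; [s] is the list of the indices of differentiation. *)
Definition smooth_on (R : realType) m n (U : set 'rV[R]_m.+1)
    (f : 'rV[R]_m.+1 -> 'rV[R]_n.+1) : Prop :=
  forall (s : seq 'I_m.+1) x, U x ->
    differentiable (foldr (@partial R m.+1 n.+1) f s) x.

(* [X] is total but only its values on [U] matter. [lp_image] and
   [lp_inverse] say that [X] is a homeomorphism from [U] onto a relatively open
   subset of [S] (the continuity of [X] follows from smoothness). *)
Record local_param (R : realType) (S : set 'rV[R]_3)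
    (U : set 'rV[R]_2) (X : 'rV[R]_2 -> 'rV[R]_3) : Prop := LocalParam {
  lp_open : open U ;
  lp_smooth : smooth_on U X ;
  lp_image : exists2 V : set 'rV[R]_3, open V & X @` U = V `&` S ;
  lp_inverse : exists2 Y : 'rV[R]_3 -> 'rV[R]_2,
    (forall u, U u -> Y (X u) = u) & {within X @` U, continuous Y} ;
  lp_immersion : forall u, U u -> row_free ('J X u) }.

Definition regular_surface (R : realType) (S : set 'rV[R]_3) : Prop :=
  forall p, S p -> exists U X, local_param S U X /\ (X @` U) p.

Definition unit_normal (R : realType) (S : set 'rV[R]_3)
    (N : 'rV[R]_3 -> 'rV[R]_3) : Prop :=
  forall U X, local_param S U X ->
    smooth_on U (N \o X) /\
    forall u, U u -> dot (N (X u)) (N (X u)) = 1 /\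
      forall i, dot (N (X u)) (partial i X u) = 0.

(* When [X] is a local parametrization and [N] a unit normal, there is exactly
   one such matrix, because the [partial j X u] form a basis of the tangent
   plane, which contains the [partial i (N \o X) u]. *)
Definition weingarten (R : realType) (N : 'rV[R]_3 -> 'rV[R]_3)
    (X : 'rV[R]_2 -> 'rV[R]_3) (u : 'rV[R]_2) : 'M[R]_2 :=
  xget 0 [set W : 'M[R]_2 | forall i,
    partial i (N \o X) u = \sum_j W i j *: partial j X u].

Definition mean_curvature (R : realType) (N : 'rV[R]_3 -> 'rV[R]_3)
    (X : 'rV[R]_2 -> 'rV[R]_3) (u : 'rV[R]_2) : R :=
  - (1 / 2) * \tr (weingarten N X u).

Definition gauss_curvature (R : realType) (N : 'rV[R]_3 -> 'rV[R]_3)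
    (X : 'rV[R]_2 -> 'rV[R]_3) (u : 'rV[R]_2) : R :=
  \det (weingarten N X u).

Definition support (R : realType) (N : 'rV[R]_3 -> 'rV[R]_3) (p : 'rV[R]_3) : R :=
  dot p (N p).

Definition sqdist (R : realType) (p : 'rV[R]_3) : R := dot p p.

Definition ss_radius (R : realType) (N : 'rV[R]_3 -> 'rV[R]_3)
    (X : 'rV[R]_2 -> 'rV[R]_3) (u : 'rV[R]_2) : R :=
  mean_curvature N X u / gauss_curvature N X u + support N (X u) / 2.

(* The curvatures at [p] do not depend on the local parametrization around [p]
   used to compute them, so conditions on them are required for all of them. *)
Record SS_surface (R : realType) (S : set 'rV[R]_3)
    (N : 'rV[R]_3 -> 'rV[R]_3) : Prop := SSSurface {
  ss_regular : regular_surface S ;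
  ss_normal : unit_normal S N ;
  ss_curved : forall U X u, local_param S U X -> U u ->
    gauss_curvature N X u != 0 ;
  ss_sphere : forall U X u, local_param S U X -> U u ->
    sphere (X u + ss_radius N X u *: N (X u)) (ss_radius N X u) 0 }.

Lemma ss_sphereE (R : realType) (N : 'rV[R]_3 -> 'rV[R]_3)
    (X : 'rV[R]_2 -> 'rV[R]_3) (u : 'rV[R]_2) :
  dot (N (X u)) (N (X u)) = 1 -> gauss_curvature N X u != 0 ->
  sphere (X u + ss_radius N X u *: N (X u)) (ss_radius N X u) 0 <->
  2 * support N (X u) * mean_curvature N X u +
    (sqdist (X u) + support N (X u) ^+ 2) * gauss_curvature N X u = 0.
Proof.
rewrite /sphere /ss_radius /= => N1 K0.
set r := _ + _ / 2.
have -> : dot (0 - (X u + r *: N (X u))) (0 - (X u + r *: N (X u))) =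
    sqdist (X u) + 2 * r * support N (X u) + r ^+ 2 * dot (N (X u)) (N (X u)).
  rewrite /sqdist /support /dot !mulr_sumr -!big_split /=.
  by apply: eq_bigr => i _; rewrite !mxE; ring.
have -> : 2 * support N (X u) * mean_curvature N X u +
    (sqdist (X u) + support N (X u) ^+ 2) * gauss_curvature N X u =
    (sqdist (X u) + 2 * r * support N (X u)) * gauss_curvature N X u.
  by rewrite /r; field.
rewrite N1 mulr1; split=> [|/eqP].
  by rewrite -[RHS]add0r => /addIr ->; rewrite mul0r.
by rewrite mulf_eq0 (negPf K0) orbF => /eqP ->; rewrite add0r.
Qed.

(* Main.v *)
Require Import Defs.
From mathcomp Require Import all_boot all_order all_algebra.
From mathcomp Require Import all_classical all_reals all_analysis.
From mathcomp Require Import ring lra.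
Import numFieldNormedType.Exports.
Local Open Scope classical_set_scope.
Local Open Scope ring_scope.

(* Write psi = <p, N> and dpsi = <p, dN>.  As K is nowhere zero, the third
   fundamental form is a metric, and the defining equation of an SS-surface
   reads psi * Delta psi = |grad psi|^2 for its Laplacian: log |psi| is harmonic
   wherever psi does not vanish.  By the strong maximum principle psi^2, which
   attains its maximum on the compact surface, is constant; then dpsi = 0, so
   p = psi N and the surface lies on the sphere of center 0 and radius |psi|.
   It is the whole sphere: for q on the sphere, the point p of the surface
   maximizing <p, q> has normal parallel to q, so p = q or p = -q, and the
   second case would make the surface a single point.

   The maximum principle is proved with the function psi^(2k) / (1 - <N, a>) for
   a = N(p1) with psi(p1)^2 not maximal: -log (1 - <N, a>) has Laplacian 1, and
   this strictly subharmonic perturbation of log psi^2 has no interior maximum.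
   Its pole at p1 lies outside the region where the function is compared, and
   since p1 may be taken arbitrarily close to a given maximum point of psi^2,
   no Hopf boundary lemma is needed. *)

Set Implicit Arguments.
Unset Strict Implicit.
Unset Printing Implicit Defensive.
Import Order.TTheory GRing.Theory Num.Theory.

(** * Directional derivatives and the second derivative test *)

Lemma is_derive_line (R : realType) (V W : normedModType R) (f : V -> W)
    (u e : V) (s : R) (df : W) :
  is_derive (u + s *: e) e f df ->
  is_derive s 1 (fun t : R => f (u + t *: e)) df.
Proof.
move=> [dfd dfE].
have E : (fun h : R => h^-1 *: (((fun t : R => f (u + t *: e)) \o shift s) (h *: 1)
    - f (u + s *: e))) =
    (fun h : R => h^-1 *: ((f \o shift (u + s *: e)) (h *: e) - f (u + s *: e))).
  by apply/funext => h /=; rewrite [h *: 1]mulr1 scalerDl addrCA.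
by split; [rewrite /derivable E|rewrite /derive E].
Qed.

(** Restriction to the line through [u] reduces this to one variable, where Fermat's rule gives
    [g u = 0]. If the second derivative were positive, [g] would be positive on the line just after
    [u], and the mean value theorem would push [f] above [f u]. *)
Lemma second_derivative_test (R : realType) (V : normedModType R)
    (f g : V -> R) (u e : V) :
  (\forall v \near u, is_derive v e f (g v)) -> derivable g u e ->
  (\forall v \near u, f v <= f u) -> g u = 0 /\ 'D_e g u <= 0.
Proof.
move=> fg dg fmax.
pose l (s : R) := u + s *: e.
have l0 : l 0 = u by rewrite /l scale0r addr0.
have lcvg : l s @[s --> 0] --> u.
  rewrite -[X in _ --> X]l0; apply: cvgD; first exact: cvg_cst.
  by apply: cvgZr_tmp; exact: cvg_id.
have [d d0 hd] : exists2 d : R, 0 < d & forall s : R, `|s| < d ->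
    is_derive s (1 : R) (f \o l) (g (l s)) /\ f (l s) <= f u.
  have fi : nbhs u [set v | is_derive v e f (g v) /\ f v <= f u].
    exact: filterI.
  have h : nbhs (0 : R) (l @^-1` _) := lcvg _ fi.
  have [d /= d0 hd] := (nbhs_ballP _ _).1 h.
  exists d; first exact: d0.
  move=> s sd; have [h1 h2] : is_derive (l s) e f (g (l s)) /\ f (l s) <= f u.
    by apply: hd; rewrite -ball_normE /= sub0r normrN.
  by split; [exact: is_derive_line h1|exact: h2].
have din (s : R) : s \in `](- d), d[ -> `|s| < d.
  by rewrite in_itv /= ltr_norml.
have G0 : g u = 0.
  have h0 : is_derive (0 : R) (1 : R) (f \o l) 0.
    apply: (@derive1_at_max _ _ (- d) d 0); first by lra.
    - by move=> t /din /hd [[]].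
    - by rewrite in_itv /=; lra.
    - by move=> t /din /hd [_]; rewrite /= l0.
  have [h1 _] : is_derive (0 : R) (1 : R) (f \o l) (g (l 0)) /\ f (l 0) <= f u.
    by apply: hd; rewrite normr0.
  by rewrite -l0 -(@derive_val _ _ _ _ _ _ _ h1) (@derive_val _ _ _ _ _ _ _ h0).
split=> //; rewrite leNgt; apply/negP => D0.
have dgl : is_derive (0 : R) (1 : R) (g \o l) ('D_e g u).
  by apply: is_derive_line; rewrite scale0r addr0; exact: derivableP.
have df : derivable (g \o l) (0 : R) 1 by case: dgl.
have dE : 'D_1 (g \o l) (0 : R) = 'D_e g u by case: dgl.
(* As [g u = 0], this is the difference quotient of [g] at [u], whose limit is positive by [D0]. *)
have : \forall h \near (0 : R)^', 0 < h^-1 * g (l h).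
  have := df; rewrite /derivable.
  move/cvg_ex => [L hL].
  have LE : L = 'D_e g u by rewrite -dE; apply/esym/cvg_lim.
  move/cvgrPdist_lt : hL => /(_ _ D0).
  apply: filterS => h; rewrite LE /= addr0 [h *: 1]mulr1 l0 G0 subr0.
  by move=> /ltr_normlP [_]; rewrite ltrBlDr ltrDl.
rewrite -nbhs_nearE => /nbhs_ballP[r /= r0 hr].
pose h := Num.min r d / 2.
have h0 : 0 < h by rewrite divr_gt0 // lt_min r0.
have hlt : h < r /\ h < d.
  have := lexx (Num.min r d); rewrite {1}ge_min /h; case: (lerP r d) => *; lra.
have Gpos c : 0 < c -> c <= h -> 0 < g (l c).
  move=> c0 ch; have : ball 0 r c.
    by rewrite -ball_normE /= sub0r normrN gtr0_norm //; lra.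
  by move/hr => /(_ (lt0r_neq0 c0)); rewrite pmulr_rgt0 // invr_gt0.
have [||c] := @MVT _ (f \o l) (g \o l) 0 h h0.
- move=> x; rewrite in_itv /= => /andP[x0 xh].
  by have [|h1 _] := hd x; first by rewrite gtr0_norm //; lra.
- apply: derivable_within_continuous => x; rewrite in_itv /= => /andP[x0 xh].
  by have [|[h1 _] _] := hd x; first by rewrite ger0_norm //; lra.
rewrite in_itv /= => /andP[c0 ch] E.
have [|_] := hd h; first by rewrite gtr0_norm // hlt.2.
have : 0 < g (l c) * (h - 0) by rewrite mulr_gt0 ?subr0 // Gpos // ltW.
by rewrite -E l0; lra.
Qed.

(** * The Euclidean inner product and its derivatives *)

Section Dot.
Variables (R : realType) (n : nat).
Implicit Types p q r : 'rV[R]_n.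

Lemma dotE p q : dot p q = (p *m q^T) 0 0.
Proof. by rewrite mxE; apply: eq_bigr => i _; rewrite mxE. Qed.

Lemma dotC p q : dot p q = dot q p.
Proof. by apply: eq_bigr => i _; rewrite mulrC. Qed.

Lemma dotDl p q r : dot (p + q) r = dot p r + dot q r.
Proof. by rewrite !dotE mulmxDl mxE. Qed.

Lemma dotDr p q r : dot r (p + q) = dot r p + dot r q.
Proof. by rewrite !(dotC r) dotDl. Qed.

Lemma dotZl a p q : dot (a *: p) q = a * dot p q.
Proof. by rewrite !dotE -scalemxAl mxE. Qed.

Lemma dotZr a p q : dot p (a *: q) = a * dot p q.
Proof. by rewrite !(dotC p) dotZl. Qed.

Lemma dotNl p q : dot (- p) q = - dot p q.
Proof. by rewrite -scaleN1r dotZl mulN1r. Qed.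

Lemma dotNr p q : dot p (- q) = - dot p q.
Proof. by rewrite !(dotC p) dotNl. Qed.

Lemma dot0l p : dot 0 p = 0.
Proof. by rewrite -(scale0r 0) dotZl mul0r. Qed.

Lemma dot_ge0 p : 0 <= dot p p.
Proof. by apply: sumr_ge0 => i _; exact: sqr_ge0. Qed.

Lemma dot_eq0 p : dot p p = 0 -> p = 0.
Proof.
move=> /eqP; rewrite psumr_eq0 => [/allP h|i _]; last exact: sqr_ge0.
apply/rowP => i; rewrite mxE; apply/eqP.
by have := h i (mem_index_enum _); rewrite /= mulf_eq0 orbb.
Qed.

End Dot.

Lemma is_derive_dot (R : realType) (V : normedModType R) n
    (f g : V -> 'rV[R]_n) (x v : V) :
  derivable f x v -> derivable g x v ->
  is_derive x v (fun y => dot (f y) (g y))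
    (dot ('D_v f x) (g x) + dot (f x) ('D_v g x)).
Proof.
move=> df dg; have /derivable_mxP dfi := df; have /derivable_mxP dgi := dg.
rewrite /dot -big_split /=.
have -> : (fun y => \sum_(i < n) f y 0 i * g y 0 i) =
    \sum_(i < n) ((fun y => f y 0 i) * (fun y => g y 0 i)).
  by apply/funext => y; rewrite fct_sumE.
apply: is_derive_eq.
  by apply: is_derive_sum => i; apply: is_deriveM; exact: derivableP.
apply: eq_bigr => i _; rewrite (derive_mx df) (derive_mx dg) !mxE [RHS]addrC.
by congr (_ + _); exact: mulrC.
Qed.

Lemma is_derive_dot_cst (R : realType) (V : normedModType R) n
    (f : V -> 'rV[R]_n) a u e : derivable f u e ->
  is_derive u e (fun v => dot (f v) a) (dot ('D_e f u) a).
Proof.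
move=> df; have h := is_derive_dot df (derivable_cst a u e).
by apply: is_derive_eq; rewrite derive_cst (dotC (f u)) dot0l addr0.
Qed.

(** * Linear algebra of normals, frames and the Weingarten matrix *)

Lemma orthogonal_submx (F : fieldType) m1 m2 n (A : 'M[F]_(m1, n))
    (B : 'M[F]_(m2, n)) m (v : 'M[F]_(m, n)) :
  A *m B^T = 0 -> (\rank A + \rank B = n)%N -> v *m B^T = 0 -> (v <= A)%MS.
Proof.
move=> AB rAB vB; have AK : (A <= kermx B^T)%MS by apply/sub_kermxP.
(* By rank-nullity the row space of [A] fills the orthogonal complement of the rows of [B], in which
   it is contained. *)
have rK : \rank A = \rank (kermx B^T).
  by rewrite mxrank_ker mxrank_tr -[LHS](addnK (\rank B)) rAB.
apply: submx_trans (_ : (kermx B^T <= A)%MS); first exact/sub_kermxP.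
by rewrite -(geq_leqif (mxrank_leqif_sup AK)) rK.
Qed.

Lemma dot_mulmx_tr (R : realType) m n (A : 'M[R]_(m, n)) (v : 'rV[R]_n) :
  (forall i, dot v (row i A) = 0) -> v *m A^T = 0.
Proof.
move=> h; apply/rowP => i; rewrite [RHS]mxE -(h i) mxE.
by apply: eq_bigr => j _; rewrite !mxE.
Qed.

Section UnitNormalAlgebra.
Variables (R : realType) (A : 'M[R]_(2, 3)) (n : 'rV[R]_3).
Hypotheses (rA : row_free A) (n1 : dot n n = 1)
  (nA : forall i, dot n (row i A) = 0).

Let rn : \rank n = 1%N.
Proof.
rewrite rank_rV; case: eqP n1 => // ->.
by rewrite dot0l => /eqP; rewrite eq_sym oner_eq0.
Qed.

Let rA2 : \rank A = 2%N. Proof. exact/eqP. Qed.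

(** The ranks 2 of [A] and 1 of [n] add up to 3. It serves with [A] the Jacobian of a chart, and
    also with [A] the Jacobian of the normal, to recover the position vector. *)
Lemma normal_direction v : (forall i, dot v (row i A) = 0) -> v = dot v n *: n.
Proof.
move=> /dot_mulmx_tr vA.
have /sub_rVP[c vE] : (v <= n)%MS.
  by apply: orthogonal_submx vA; [exact: dot_mulmx_tr|rewrite rn rA2].
by rewrite [in dot _ _]vE dotZl n1 mulr1.
Qed.

Lemma tangent_direction m (v : 'M[R]_(m, 3)) :
  (forall i, dot n (row i v) = 0) -> (v <= A)%MS.
Proof.
move=> /dot_mulmx_tr nv.
apply: (@orthogonal_submx _ _ _ _ _ n).
- by apply: trmx_inj; rewrite trmx_mul trmxK trmx0; exact: dot_mulmx_tr.
- by rewrite rn rA2.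
- by apply: trmx_inj; rewrite trmx_mul trmxK trmx0.
Qed.

End UnitNormalAlgebra.

(** Gram-Schmidt for the metric of Gram matrix [A *m A^T]. With [A] the Jacobian of the unit normal
    this metric is the third fundamental form. *)
Lemma orthonormal_frame (R : realType) m (A : 'M[R]_(2, m)) : row_free A ->
  exists e1 e2 : 'rV[R]_2, [/\ dot (e1 *m A) (e1 *m A) = 1,
    dot (e2 *m A) (e2 *m A) = 1 & dot (e1 *m A) (e2 *m A) = 0].
Proof.
move=> rA.
have nz (e : 'rV[R]_2) : e != 0 -> 0 < dot (e *m A) (e *m A).
  move=> e0; rewrite lt_neqAle dot_ge0 andbT eq_sym; apply/eqP => /dot_eq0 eA.
  by move: e0; rewrite -(mulmx_free_eq0 e rA) eA eqxx.
have normalize (e : 'rV[R]_2) : e != 0 ->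
    exists c : R, dot ((c *: e) *m A) ((c *: e) *m A) = 1.
  move=> /nz h; exists (Num.sqrt (dot (e *m A) (e *m A)))^-1.
  rewrite -scalemxAl dotZl dotZr mulrA -expr2 exprVn sqr_sqrtr ?(ltW h) //.
  by rewrite mulVf // gt_eqF.
have d0 : delta_mx 0 0 != 0 :> 'rV[R]_2.
  by apply/eqP => /rowP/(_ 0)/eqP; rewrite !mxE oner_eq0.
(* The vanishing second coordinate of [e1] leaves that of [f2] equal to 1, hence [f2] is nonzero. *)
have [e1 e11 h1] : exists2 e : 'rV[R]_2, e 0 1 = 0 & dot (e *m A) (e *m A) = 1.
  have [c h] := normalize _ d0; exists (c *: delta_mx 0 0) => //.
  by rewrite !mxE mulr0.
pose f2 : 'rV[R]_2 := delta_mx 0 1 - dot (delta_mx 0 1 *m A) (e1 *m A) *: e1.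
have f0 : f2 != 0.
  apply/eqP => /rowP/(_ 1)/eqP; rewrite !mxE e11 /=.
  by rewrite mulr0 subr0 oner_eq0.
have [c2 h2] := normalize _ f0.
exists e1, (c2 *: f2); split => //.
rewrite -scalemxAl dotZr mulmxBl dotDr dotNr -scalemxAl dotZr h1 mulr1 dotC subrr.
by rewrite mulr0.
Qed.

(** The adjugate of a 2 by 2 matrix swaps the diagonal entries and so keeps the trace. *)
Lemma mxtrace_invmx2 (F : fieldType) (W : 'M[F]_2) :
  \det W != 0 -> \tr (invmx W) * \det W = \tr W.
Proof.
move=> W0; have uW : W \in unitmx by rewrite unitmxE unitfE.
rewrite /invmx uW mxtraceZ mulrAC mulVf // mul1r.
rewrite /mxtrace !big_ord_recl !big_ord0 !addr0 !mxE /cofactor !det_mx11 !mxE /=.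
rewrite addrC; congr (_ + _); rewrite /= ?expr0 ?mul1r.
  by rewrite expr2 mulrNN !mul1r; congr (W _ _); exact/val_inj.
by congr (W _ _); exact/val_inj.
Qed.

(** With [A] the Jacobian of the normal and [B] that of the chart, the sum is the trace of
    [invmx W], that is [- 2 * H / K]. The matrix [E] of the frame satisfies
    [E *m A *m (E *m A)^T = 1], so the trace of [E *m B *m (E *m A)^T] becomes that of [invmx W] by
    cyclicity. *)
Lemma frame_trace (R : realType) m (A B : 'M[R]_(2, m)) (W : 'M[R]_2)
    (e1 e2 : 'rV[R]_2) :
  \det W != 0 -> A = W *m B ->
  dot (e1 *m A) (e1 *m A) = 1 -> dot (e2 *m A) (e2 *m A) = 1 ->
  dot (e1 *m A) (e2 *m A) = 0 ->
  (dot (e1 *m B) (e1 *m A) + dot (e2 *m B) (e2 *m A)) * \det W = \tr W.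
Proof.
move=> W0 AWB h1 h2 h12; have uW : W \in unitmx by rewrite unitmxE unitfE.
pose E : 'M[R]_2 := \matrix_(i, j) (if i == 0 then e1 0 j else e2 0 j).
have Er0 : row 0 E = e1 by apply/rowP => j; rewrite !mxE.
have Er1 : row 1 E = e2 by apply/rowP => j; rewrite !mxE.
have ent (C D : 'M[R]_(2, m)) i j :
    (E *m C *m (E *m D)^T) i j = dot (row i E *m C) (row j E *m D).
  rewrite -!row_mul mxE; apply: eq_bigr => k _.
  by rewrite [in LHS](mxE _ _ k) !mxE.
have BA : B = invmx W *m A by rewrite AWB mulKmx.
have EA : E *m A *m (E *m A)^T = 1%:M.
  apply/matrixP => i j; rewrite ent.
  have ord2 (l : 'I_2) : l = 0 \/ l = 1.
    by case: l => [[|[|//]] ?]; [left|right]; exact/val_inj.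
  by case: (ord2 i) => ->; case: (ord2 j) => ->; rewrite ?Er0 ?Er1 mxE //= dotC.
have -> : dot (e1 *m B) (e1 *m A) + dot (e2 *m B) (e2 *m A) =
    \tr (E *m B *m (E *m A)^T).
  rewrite /mxtrace !big_ord_recl big_ord0 addr0 !ent Er0.
  by rewrite (_ : lift 0 0 = 1) ?Er1 //; apply/val_inj.
rewrite BA -(mxtrace_invmx2 W0); congr (_ * _).
rewrite -mulmxA mxtrace_mulC -!mulmxA.
have -> : A *m ((E *m A)^T *m E) = 1%:M.
  by rewrite mulmxA; apply: mulmx1C; rewrite mulmxA.
by rewrite mulmx1.
Qed.

(** * Directional derivatives of smooth maps *)

Section SmoothOn.
Variables (R : realType) (m n : nat) (U : set 'rV[R]_m.+1)
  (f : 'rV[R]_m.+1 -> 'rV[R]_n.+1).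
Hypotheses (oU : open U) (sf : smooth_on U f).

Lemma smooth_differentiable u : U u -> differentiable f u.
Proof. exact: (sf [::]). Qed.

Lemma smooth_derivable u e : U u -> derivable f u e.
Proof. by move=> Uu; exact/diff_derivable/smooth_differentiable. Qed.

Lemma smooth_continuous u : U u -> {for u, continuous f}.
Proof. by move=> Uu; exact/differentiable_continuous/smooth_differentiable. Qed.

Lemma partial_jacobian u i : U u -> partial i f u = row i ('J f u).
Proof.
move=> Uu; rewrite /partial deriveEjacobian ?rowE //.
exact: smooth_differentiable.
Qed.

Lemma smooth_deriveE u e : U u -> 'D_e f u = e *m 'J f u.
Proof. by move=> Uu; rewrite deriveEjacobian //; exact: smooth_differentiable. Qed.

Lemma smooth_derive_partial u e : U u ->
  'D_e f u = \sum_i e 0 i *: partial i f u.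
Proof.
move=> Uu; rewrite smooth_deriveE // mulmx_sum_row.
by apply: eq_bigr => i _; rewrite partial_jacobian.
Qed.

(** Near [u], ['D_e f] is a combination with constant coefficients of the partial derivatives, which
    are differentiable. *)
Lemma smooth_derive_derivable u e e' : U u -> derivable ('D_e f) u e'.
Proof.
move=> Uu.
have h : derivable (\sum_i (fun v => e 0 i *: partial i f v)) u e'.
  apply: derivable_sum => i; apply: derivableZ.
  exact/diff_derivable/(sf [:: i]).
apply: near_eq_derivable h.
near=> v; rewrite fct_sumE smooth_derive_partial //.
by near: v; exact: open_nbhs_nbhs.
Unshelve. all: by end_near. Qed.

End SmoothOn.

(** * The pointwise identity at a critical point of the barrier *)

Lemma dot_frame (R : realType) (n n1 n2 v w : 'rV[R]_3) :
  dot n n = 1 -> dot n1 n1 = 1 -> dot n2 n2 = 1 ->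
  dot n n1 = 0 -> dot n n2 = 0 -> dot n1 n2 = 0 ->
  dot v w = dot v n * dot w n + dot v n1 * dot w n1 + dot v n2 * dot w n2.
Proof.
move=> h h1 h2 h01 h02 h12.
pose M : 'M[R]_3 := \matrix_(i, j) [:: n; n1; n2]`_i 0 j.
have Mr (i : 'I_3) : row i M = [:: n; n1; n2]`_i.
  by apply/rowP => j; rewrite !mxE.
have ent l1 l2 (A : 'M[R]_(l1, 3)) (B : 'M[R]_(l2, 3)) i j :
    (A *m B^T) i j = dot (row i A) (row j B).
  by rewrite mxE; apply: eq_bigr => k _; rewrite !mxE.
have MM : M *m M^T = 1%:M.
  apply/matrixP => i j; rewrite ent !Mr mxE.
  have [h10 h20 h21] : [/\ dot n1 n = 0, dot n2 n = 0 & dot n2 n1 = 0].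
    by rewrite !(dotC n1 n, dotC n2).
  by case: i => [[|[|[|//]]] ?]; case: j => [[|[|[|//]]] ?].
have -> : dot v w = dot (v *m M^T) (w *m M^T).
  rewrite !dotE trmx_mul trmxK !mulmxA -(mulmxA v) (mulmx1C MM) mulmx1 //.
have E (u : 'rV[R]_3) (i : 'I_3) : (u *m M^T) 0 i = dot u [:: n; n1; n2]`_i.
  by rewrite ent Mr; congr dot; apply/rowP => j; rewrite mxE.
by rewrite {1}/dot !big_ord_recl big_ord0 addr0 !E /= addrA.
Qed.

(* At a critical point of [psi ^+ (2 * k.+1) + P * t], where [p1, p2] and
   [t1, t2] are the first derivatives of [psi] and [t]; [G1] and [G2] are
   Christoffel terms, which cancel. *)
Lemma barrier_algebra (R : realType) (k : nat)
    (psi p1 p2 t t1 t2 P tau G1 G2 xn an : R) :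
  0 < P -> 0 < 1 - t -> psi ^+ (2 * k.+1) = P * (1 - t) ->
  1 = t ^+ 2 + t1 ^+ 2 + t2 ^+ 2 ->
  psi * tau = (psi ^+ 2 + p1 ^+ 2 + p2 ^+ 2) + psi ^+ 2 ->
  xn = - 2 * psi + p1 * G1 + p2 * G2 ->
  an = - 2 * t + t1 * G1 + t2 * G2 ->
  (2 * k.+1)%:R * psi ^+ (2 * k).+1 * p1 + P * t1 = 0 ->
  (2 * k.+1)%:R * psi ^+ (2 * k).+1 * p2 + P * t2 = 0 ->
  (2 * k.+1)%:R * ((2 * k).+1%:R * psi ^+ (2 * k) * (p1 ^+ 2 + p2 ^+ 2)
    + psi ^+ (2 * k).+1 * (tau + xn)) + P * an = P * (1 - t).
Proof.
move=> P0 t0 Ept; have -> : (2 * k.+1 = (2 * k).+2)%N by rewrite mulnS.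
move: Ept; have -> : (2 * k.+1 = (2 * k).+2)%N by rewrite mulnS.
move: (2 * k)%N => l; rewrite (exprS psi l.+1) (exprS psi l) -[l.+2%:R]natr1.
set s := l.+1%:R; move: (psi ^+ l) => q Eq E1 Et -> -> g1 g2.
(* Sum of the squares of the two critical point equations: [t1 ^+ 2 + t2 ^+ 2] factors as
   [(1 - t) * (1 + t)], and the common factor [P * (1 - t)] cancels. *)
have Eg : ((s + 1) * q) * (p1 ^+ 2 + p2 ^+ 2) * (s + 1) = P * (1 + t).
  have P1 : P * (1 - t) != 0 by rewrite gt_eqF // mulr_gt0.
  apply: (mulfI P1).
   transitivity (((s + 1) * (psi * q) * p1) ^+ 2 + ((s + 1) * (psi * q) * p2) ^+ 2).
    by rewrite -Eq; ring.
  have -> : (s + 1) * (psi * q) * p1 = - (P * t1) by lra.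
  have -> : (s + 1) * (psi * q) * p2 = - (P * t2) by lra.
  transitivity (P ^+ 2 * (t1 ^+ 2 + t2 ^+ 2)); first by ring.
  have -> : t1 ^+ 2 + t2 ^+ 2 = 1 - t ^+ 2 by lra.
  by ring.
(* The Christoffel terms are gathered as multiples of the critical point equations. *)
transitivity ((s + 1) * q * (p1 ^+ 2 + p2 ^+ 2) * s
  + (s + 1) * q * (psi * tau - 2 * psi ^+ 2)
  + G1 * ((s + 1) * (psi * q) * p1 + P * t1)
  + G2 * ((s + 1) * (psi * q) * p2 + P * t2) - 2 * t * P); first by ring.
rewrite Et g1 g2 !mulr0 !addr0.
transitivity ((s + 1) * q * (p1 ^+ 2 + p2 ^+ 2) * (s + 1) - 2 * t * P).
  by ring.
by rewrite Eg; ring.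
Qed.

(** * First and second derivatives of a unit normal field and of the support function *)

Section UnitNormalField.
Variables (R : realType) (U : set 'rV[R]_2) (x n : 'rV[R]_2 -> 'rV[R]_3).
Hypotheses (oU : open U) (sx : smooth_on U x) (sn : smooth_on U n).
Hypotheses (n1 : forall u, U u -> dot (n u) (n u) = 1)
  (nx : forall u i, U u -> dot (n u) (partial i x u) = 0).

Let psi u := dot (x u) (n u).

Lemma dot_normal_derive u e : U u -> dot (n u) ('D_e x u) = 0.
Proof.
move=> Uu; rewrite (smooth_deriveE sx) // dotE trmx_mul mulmxA.
have -> : n u *m ('J x u)^T = 0.
  apply: dot_mulmx_tr => i.
  by have := nx i Uu; rewrite (partial_jacobian sx).
by rewrite mul0mx mxE.
Qed.

Lemma dot_normal_derive_normal u e : U u -> dot (n u) ('D_e n u) = 0.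
Proof.
move=> Uu.
have dn : derivable n u e := smooth_derivable sn Uu.
have [_ h] := is_derive_dot dn dn.
have : 'D_e (fun v => dot (n v) (n v)) u = 0.
  rewrite -[RHS](derive_cst (1 : R) u e); apply: near_eq_derive.
  by near=> v; rewrite n1 //; near: v; exact: open_nbhs_nbhs.
by rewrite h (dotC ('D_e n u)) => /eqP; rewrite -mulr2n mulrn_eq0 => /eqP.
Unshelve. all: by end_near. Qed.

(** Differentiate [dot n ('D_e n) = 0] once more. For [e] of length 1 in the third fundamental form
    the value is -1, which makes [dot n a] satisfy the equation of a linear function on the unit
    sphere. *)
Lemma dot_normal_derive2 u e : U u ->
  dot (n u) ('D_e ('D_e n) u) = - dot ('D_e n u) ('D_e n u).
Proof.
move=> Uu.
have dn : derivable n u e := smooth_derivable sn Uu.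
have [_ h] := is_derive_dot dn (smooth_derive_derivable (e := e) (e' := e) oU sn Uu).
have : 'D_e (fun v => dot (n v) ('D_e n v)) u = 0.
  rewrite -[RHS](derive_cst (0 : R) u e); apply: near_eq_derive.
  near=> v; rewrite dot_normal_derive_normal //; near: v; exact: open_nbhs_nbhs.
by rewrite h => /eqP; rewrite addrC addr_eq0 => /eqP.
Unshelve. all: by end_near. Qed.

Lemma is_derive_support u e : U u -> is_derive u e psi (dot (x u) ('D_e n u)).
Proof.
move=> Uu; have h := is_derive_dot (smooth_derivable sx Uu) (smooth_derivable sn Uu).
by apply: is_derive_eq; rewrite dotC dot_normal_derive // add0r.
Qed.

End UnitNormalField.

(** * The barrier: its derivatives and the absence of interior maxima *)

Section ScalarDerivatives.
Variables (R : realType) (V : normedModType R).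
Implicit Types (f g : V -> R) (y e : V) (df dg c : R).

Lemma is_derive_add f g y e df dg : is_derive y e f df -> is_derive y e g dg ->
  is_derive y e (fun v => f v + g v) (df + dg).
Proof. exact: is_deriveD. Qed.

Lemma is_derive_mul f g y e df dg : is_derive y e f df -> is_derive y e g dg ->
  is_derive y e (fun v => f v * g v) (f y * dg + g y * df).
Proof. exact: is_deriveM. Qed.

Lemma is_derive_mull f c y e df : is_derive y e f df ->
  is_derive y e (fun v => c * f v) (c * df).
Proof. exact: is_deriveZ. Qed.

Lemma is_derive_exp f k y e df : is_derive y e f df ->
  is_derive y e (fun v => f v ^+ k.+1) (k.+1%:R * f y ^+ k * df).
Proof.
move=> h; have := is_deriveX k.+1 h.
rewrite (_ : f ^+ k.+1 = fun v => f v ^+ k.+1) //.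
by apply/funext => v; rewrite exprfctE.
Qed.

End ScalarDerivatives.

(** Here [n1], [n11] and [X1] stand for the first and second derivatives of the normal and the first
    derivative of the position along one frame vector, and similarly for the other. Expanding every
    product in the basis [n], [n1], [n2] reduces the claim to [barrier_algebra]; the tangential
    components of [n11] and [n22] supply the Christoffel terms. *)
Lemma barrier_frame (R : realType) (k : nat) (P : R)
    (X n n1 n2 a X1 X2 n11 n22 : 'rV[R]_3) :
  dot n n = 1 -> dot n1 n1 = 1 -> dot n2 n2 = 1 ->
  dot n n1 = 0 -> dot n n2 = 0 -> dot n1 n2 = 0 -> dot a a = 1 ->
  dot n n11 = - 1 -> dot n n22 = - 1 -> 0 < P -> 0 < 1 - dot n a ->
  dot X n * (dot X1 n1 + dot X2 n2) = dot X X + dot X n ^+ 2 ->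
  dot X n ^+ (2 * k.+1) = P * (1 - dot n a) ->
  (2 * k.+1)%:R * (dot X n ^+ (2 * k).+1 * dot X n1) + P * dot n1 a = 0 ->
  (2 * k.+1)%:R * (dot X n ^+ (2 * k).+1 * dot X n2) + P * dot n2 a = 0 ->
  ((2 * k.+1)%:R * ((2 * k).+1%:R * dot X n ^+ (2 * k) * dot X n1 ^+ 2
     + dot X n ^+ (2 * k).+1 * (dot X1 n1 + dot X n11)) + P * dot n11 a) +
  ((2 * k.+1)%:R * ((2 * k).+1%:R * dot X n ^+ (2 * k) * dot X n2 ^+ 2
     + dot X n ^+ (2 * k).+1 * (dot X2 n2 + dot X n22)) + P * dot n22 a)
  = P * (1 - dot n a).
Proof.
move=> h h1 h2 h01 h02 h12 a1 N1 N2 P0.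
have F v w := dot_frame v w h h1 h2 h01 h02 h12.
have A1 := F a a; rewrite a1 in A1.
rewrite (F X X) (F X n11) (F X n22) (F n11 a) (F n22 a).
rewrite (dotC n11 n) (dotC n22 n) N1 N2 (dotC n1 a) (dotC n2 a) (dotC n a).
move: A1; move: (dot X n) (dot X n1) (dot X n2) (dot a n) (dot a n1) (dot a n2).
move=> ps p1 p2 t t1 t2 A1 at0 ss Pu g1 g2.
move: (dot n11 n1) (dot n11 n2) (dot n22 n1) (dot n22 n2) => c11 c12 c21 c22.
move: ss; move: (dot X1 n1) (dot X2 n2) => x1 x2 ss.
have := @barrier_algebra _ k ps p1 p2 t t1 t2 P (x1 + x2) (c11 + c21) (c12 + c22)
  _ _ P0 at0 Pu.
rewrite !expr2 -!mulrA in A1 ss * => /(_ _ _ A1 ss erefl erefl).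
rewrite g1 g2 => /(_ erefl erefl) <-.
by ring.
Qed.

Section BarrierMaximum.
Variables (R : realType) (U : set 'rV[R]_2) (x n : 'rV[R]_2 -> 'rV[R]_3).
Hypotheses (oU : open U) (sx : smooth_on U x) (sn : smooth_on U n).
Hypotheses (n1 : forall u, U u -> dot (n u) (n u) = 1)
  (nx : forall u i, U u -> dot (n u) (partial i x u) = 0).

Let psi u := dot (x u) (n u).

(** Division-free form of the quotient of [psi ^+ (2 * k.+1)] by [1 - dot n a]: where the
    denominator is positive, the quotient is at most [P] exactly when this function is at most
    [P]. *)
Let barrier k P a u : R := psi u ^+ (2 * k.+1) + P * dot (n u) a.

Let dbarrier k P a e u : R :=
  (2 * k.+1)%:R * (psi u ^+ (2 * k).+1 * dot (x u) ('D_e n u)) +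
  P * dot ('D_e n u) a.

Let is_derive_barrier k P a u e : U u ->
  is_derive u e (barrier k P a) (dbarrier k P a e u).
Proof.
move=> Uu; have hpsi := is_derive_support sx sn nx e Uu.
have ha := is_derive_dot_cst a (smooth_derivable sn (e := e) Uu).
have E : (2 * k.+1 = (2 * k).+2)%N by rewrite mulnS.
rewrite /barrier /dbarrier E mulrA.
exact: is_derive_add (is_derive_exp _ hpsi) (is_derive_mull _ ha).
Qed.

Let is_derive_dbarrier k P a u e : U u ->
  is_derive u e (dbarrier k P a e)
  ((2 * k.+1)%:R * ((2 * k).+1%:R * psi u ^+ (2 * k) * dot (x u) ('D_e n u) ^+ 2
     + psi u ^+ (2 * k).+1 *
       (dot ('D_e x u) ('D_e n u) + dot (x u) ('D_e ('D_e n) u)))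
   + P * dot ('D_e ('D_e n) u) a).
Proof.
move=> Uu; have hpsi := is_derive_support sx sn nx e Uu.
have dn2 := smooth_derive_derivable (e := e) (e' := e) oU sn Uu.
have ha := is_derive_dot_cst a dn2.
have hx := is_derive_dot (smooth_derivable sx (e := e) Uu) dn2.
have h := is_derive_add (is_derive_mull (2 * k.+1)%:R
  (is_derive_mul (is_derive_exp (2 * k) hpsi) hx)) (is_derive_mull P ha).
apply: (is_derive_eq h); rewrite /psi.
by ring.
Qed.

(** At a maximum both second derivatives would be nonpositive, while their sum is
    [P * (1 - dot (n u) a)], which is positive. The vectors [e1] and [e2] are constant in the
    parameter plane and orthonormal at [u] alone; they still detect the Laplacian there, since first
    order terms vanish at a critical point. *)
Lemma no_barrier_maximum k P a u e1 e2 : U u -> 0 < P ->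
  dot a a = 1 -> 0 < 1 - dot (n u) a ->
  dot ('D_e1 n u) ('D_e1 n u) = 1 -> dot ('D_e2 n u) ('D_e2 n u) = 1 ->
  dot ('D_e1 n u) ('D_e2 n u) = 0 ->
  psi u * (dot ('D_e1 x u) ('D_e1 n u) + dot ('D_e2 x u) ('D_e2 n u)) =
    dot (x u) (x u) + psi u ^+ 2 ->
  psi u ^+ (2 * k.+1) = P * (1 - dot (n u) a) ->
  ~ (\forall v \near u, psi v ^+ (2 * k.+1) <= P * (1 - dot (n v) a)).
Proof.
move=> Uu P0 a1 at0 h1 h2 h12 ss Pu Pmax.
have test e : dbarrier k P a e u = 0 /\ 'D_e (dbarrier k P a e) u <= 0.
  apply: (@second_derivative_test _ _ (barrier k P a)).
  - near=> v; apply: is_derive_barrier; near: v; exact: open_nbhs_nbhs.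
  - by have [] := is_derive_dbarrier k P a e Uu.
  - near=> v; rewrite /barrier Pu mulrBr subrK mulr1 -lerBrDr.
    rewrite -[X in X - _]mulr1 -mulrBr.
    by near: v.
have [g1 D1] := test e1; have [g2 D2] := test e2.
have [_ E1] := is_derive_dbarrier k P a e1 Uu; rewrite {}E1 in D1.
have [_ E2] := is_derive_dbarrier k P a e2 Uu; rewrite {}E2 in D2.
have N1 := dot_normal_derive2 oU sn n1 e1 Uu; rewrite h1 in N1.
have N2 := dot_normal_derive2 oU sn n1 e2 Uu; rewrite h2 in N2.
have K := barrier_frame (n1 Uu) h1 h2
  (dot_normal_derive_normal oU sn n1 e1 Uu)
  (dot_normal_derive_normal oU sn n1 e2 Uu) h12 a1 N1 N2 P0 at0 ss Pu g1 g2.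
have D12 := lerD D1 D2; rewrite addr0 in D12.
have : P * (1 - dot (n u) a) <= 0 := eq_ind _ (fun z => z <= 0) D12 _ K.
by rewrite leNgt mulr_gt0.
Unshelve. all: by end_near. Qed.

End BarrierMaximum.

(** * Cauchy-Schwarz and the local expansion estimate for immersions *)

Lemma dot_cauchy_schwarz (R : realType) n (p q : 'rV[R]_n) :
  dot p q ^+ 2 <= dot p p * dot q q.
Proof.
have [q0|q0] := eqVneq (dot q q) 0.
  by rewrite (dot_eq0 q0) (dotC p) !dot0l expr0n mulr0.
have qq : 0 < dot q q by rewrite lt_neqAle eq_sym q0 dot_ge0.
have := dot_ge0 (dot q q *: p - dot p q *: q).
rewrite dotDl !dotDr !dotNl !dotNr !dotZl !dotZr (dotC q p) => h.
rewrite -subr_ge0 -(pmulr_rge0 _ qq).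
by apply: le_trans h _; rewrite le_eqVlt; apply/orP; left; apply/eqP; ring.
Qed.

Lemma norm_coord_le (R : realType) n (e : 'rV[R]_n) i : `|e 0 i| <= `|e|.
Proof.
rewrite [leRHS]/Num.Def.normr /= mx_normrE.
exact: (le_bigmax _ (fun ij : 'I_1 * 'I_n => `|e ij.1 ij.2|) (0, i)).
Qed.

Lemma norm_coord_eq (R : realType) n (e : 'rV[R]_n) : e != 0 ->
  exists i, `|e| = `|e 0 i|.
Proof.
move=> e0; have /mx_norm_neq0 [[i j] h] : mx_norm e != 0.
  by apply: contra e0 => /eqP /mx_norm_eq0 ->.
by exists j; rewrite /= (ord1 i) in h; exact: h.
Qed.

Lemma cvg_dot (R : realType) n (T : Type) (F : set_system T) {FF : Filter F}
    (f g : T -> 'rV[R]_n) (a b : 'rV[R]_n) :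
  f @ F --> a -> g @ F --> b -> dot (f y) (g y) @[y --> F] --> dot a b.
Proof.
move=> fa gb; rewrite /dot.
have co (h : T -> 'rV[R]_n) (c : 'rV[R]_n) i :
      h @ F --> c -> h y 0 i @[y --> F] --> c 0 i.
  move=> hc; apply: (@continuous_cvg _ _ _ F FF h (fun M : 'rV[R]_n => M 0 i)) hc.
  exact: coord_continuous.
apply: (cvg_big add_continuous) => i _.
by apply: cvgM; exact: co.
Qed.

(* Mean value theorem for the coordinates of
   [v |-> f v *m pinvmx ('J f u0) - v], whose differential vanishes at [u0]. *)
Lemma smooth_expanding (R : realType) m n (U : set 'rV[R]_m.+1)
    (f : 'rV[R]_m.+1 -> 'rV[R]_n.+1) (u0 : 'rV[R]_m.+1) :
  open U -> smooth_on U f -> U u0 -> row_free ('J f u0) ->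
  exists rho C : R, [/\ 0 < rho, 0 < C, ball u0 rho `<=` U &
    forall u v, ball u0 rho u -> ball u0 rho v ->
      `|u - v| ^+ 2 <= C * dot (f u - f v) (f u - f v)].
Proof.
move=> oU sf Uu0 rf.
(* Pairing with [c j] reads off the [j]-th coordinate of a vector from its image under the Jacobian
   at [u0]. *)
pose c j := row j (pinvmx ('J f u0))^T.
have Mu0 i j : dot (partial i f u0) (c j) = (i == j)%:R.
  rewrite (partial_jacobian sf) //.
  have <- : ('J f u0 *m pinvmx ('J f u0)) i j = (i == j)%:R.
    by rewrite mulmxVp // mxE.
  by rewrite [RHS]mxE; apply: eq_bigr => k _; rewrite !mxE.
pose eta : R := (2 * m.+1%:R)^-1.
have eta0 : 0 < eta by rewrite invr_gt0 mulr_gt0.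
have near_u0 : \forall v \near u0, U v /\
    forall ij : 'I_m.+1 * 'I_m.+1,
      `|(ij.1 == ij.2)%:R - dot (partial ij.1 f v) (c ij.2)| < eta.
  apply: filterI; first exact: open_nbhs_nbhs.
  suff h ij : \forall v \near u0,
      `|(ij.1 == ij.2)%:R - dot (partial ij.1 f v) (c ij.2)| < eta.
    exact: (@filter_forall _ _ (fun ij v => `|(ij.1 == ij.2)%:R -
      dot (partial ij.1 f v) (c ij.2)| < eta) (nbhs u0) _ h).
  case: ij => i j /=.
  have : dot (partial i f v) (c j) @[v --> u0] --> ((i == j)%:R : R).
    rewrite -(Mu0 i j); apply: (cvg_dot (F := nbhs u0)); last exact: cvg_cst.
    exact/differentiable_continuous/(sf [:: i]).
  by move/cvgrPdist_lt => /(_ _ eta0).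
have [rho /= rho0 hrho] := (nbhs_ballP _ _).1 near_u0.
(* The factor 4 comes from squaring the bound by half the norm; the sum dominates every
   [dot (c j) (c j)], and the 1 keeps [C] positive. *)
pose C : R := 4 * (1 + \sum_j dot (c j) (c j)).
have Cc j : 4 * dot (c j) (c j) <= C.
  rewrite /C ler_pM2l // (bigD1 j) //= addrCA lerDl addr_ge0 // sumr_ge0 // => k _.
  exact: dot_ge0.
exists rho, C; split => //.
- by rewrite mulr_gt0 // ltr_pwDl // sumr_ge0 // => k _; exact: dot_ge0.
- by move=> v /hrho[].
move=> u v bu bv; set e := u - v.
have [e0|e0] := eqVneq e 0.
  rewrite e0 normr0 expr0n mulr_ge0 ?dot_ge0 //.
  by rewrite (le_trans _ (Cc 0)) // mulr_ge0 ?dot_ge0.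
have [j ej] := norm_coord_eq e0.
pose l (s : R) := v + s *: e.
have lb (s : R) : 0 <= s -> s <= 1 -> ball u0 rho (l s).
  move=> s0 s1; move: bu bv; rewrite -!ball_normE /= => bu bv.
  have -> : u0 - l s = s *: (u0 - u) + (1 - s) *: (u0 - v).
    rewrite /l /e !scalerBr scalerBl !scale1r !scalerBl opprD opprB.
    by rewrite scale1r; apply/rowP => k; rewrite !mxE; ring.
  apply: le_lt_trans (ler_normD _ _) _; rewrite !normrZ.
  rewrite (ger0_norm s0) ger0_norm ?subr_ge0 //.
  have [->|sn] := eqVneq s 0; first by rewrite mul0r add0r subr0 mul1r.
  have : s * `|u0 - u| < s * rho by rewrite ltr_pM2l // lt_neqAle eq_sym sn.
  have : (1 - s) * `|u0 - v| <= (1 - s) * rho by rewrite ler_wpM2l ?subr_ge0 // ltW.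
  by lra.
have dl (s : R) : 0 <= s -> s <= 1 ->
    is_derive s (1 : R) (fun s => dot (f (l s)) (c j)) (dot ('D_e f (l s)) (c j)).
  move=> s0 s1; apply: (@is_derive_line _ _ _ (fun w => dot (f w) (c j)) v e s).
  apply: is_derive_dot_cst; apply: (smooth_derivable sf).
  by have [] := hrho _ (lb s s0 s1).
have [||s] := @MVT _ (fun s => dot (f (l s)) (c j))
    (fun s => dot ('D_e f (l s)) (c j)) 0 1 ltr01.
- by move=> s; rewrite in_itv /= => /andP[s0 s1]; apply: dl; exact: ltW.
- apply: derivable_within_continuous => s; rewrite in_itv /= => /andP[s0 s1].
  by have [] := dl s s0 s1.
rewrite in_itv /= => /andP[s0 s1]; rewrite subr0 mulr1.
have [Ul hl] := hrho _ (lb s (ltW s0) (ltW s1)).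
have -> : l 1 = u by rewrite /l /e scale1r subrKC.
have -> : l 0 = v by rewrite /l scale0r addr0.
rewrite -dotNl -dotDl (smooth_derive_partial sf) //.
set w := f u - f v => E.
have E2 : dot w (c j) = \sum_i e 0 i * dot (partial i f (l s)) (c j).
  rewrite E /dot; under eq_bigr do rewrite summxE mulr_suml.
  rewrite exchange_big /=; apply: eq_bigr => i _.
  by rewrite mulr_sumr; apply: eq_bigr => k _; rewrite mxE mulrA.
have bound : `|e 0 j - dot w (c j)| <= `|e| / 2.
  have -> : e 0 j - dot w (c j) =
      \sum_i e 0 i * ((i == j)%:R - dot (partial i f (l s)) (c j)).
    rewrite E2; under [RHS]eq_bigr do rewrite mulrBr.
    rewrite sumrB; congr (_ - _).
    rewrite (bigD1 j) //= eqxx mulr1 big1 ?addr0 // => i /negPf ->.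
    by rewrite mulr0.
  apply: le_trans (ler_norm_sum _ _ _) _.
  apply: le_trans (_ : \sum_(i < m.+1) `|e| * eta <= _).
    apply: ler_sum => i _; rewrite normrM ler_pM // ?norm_coord_le //.
    exact: ltW (hl (i, j)).
  rewrite sumr_const card_ord -mulr_natr /eta le_eqVlt; apply/orP; left; apply/eqP.
  by field.
have half : `|e| / 2 <= `|dot w (c j)|.
  have := ler_normD (e 0 j - dot w (c j)) (dot w (c j)); rewrite subrK -ej.
  by lra.
have : (`|e| / 2) ^+ 2 <= dot w (c j) ^+ 2.
  by rewrite -[leRHS]real_normK ?num_real // lerXn2r // nnegrE // divr_ge0.
move=> /le_trans /(_ (dot_cauchy_schwarz _ _)) h.
apply: le_trans (_ : 4 * dot (c j) (c j) * dot w w <= _).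
  by rewrite exprMn in h; lra.
by rewrite ler_wpM2r ?dot_ge0.
Qed.

Lemma unit_distE (R : realType) n (p q : 'rV[R]_n) :
  dot p p = 1 -> dot q q = 1 -> dot (p - q) (p - q) = 2 * (1 - dot p q).
Proof.
by move=> p1 q1; rewrite dotDl !dotDr !dotNl !dotNr p1 q1 (dotC q p); ring.
Qed.

Lemma expr_lt_eps (R : realType) (z e : R) : 0 <= z -> z < 1 -> 0 < e ->
  exists k, z ^+ k.+1 < e.
Proof.
move=> z0 z1 e0; have : z ^+ k @[k --> \oo] --> 0.
  by apply: cvg_expr; rewrite ger0_norm.
move/cvgrPdist_lt => /(_ _ e0) [k _ /(_ k.+1 (leqnSn k))].
by rewrite /= sub0r normrN ger0_norm ?exprn_ge0 // => h; exists k.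
Qed.

(** * The strong maximum principle for the squared support function *)

Section StrongMaximum.
Variables (R : realType) (U : set 'rV[R]_2) (x n : 'rV[R]_2 -> 'rV[R]_3).
Hypotheses (oU : open U) (sx : smooth_on U x) (sn : smooth_on U n).
Hypotheses (n1 : forall u, U u -> dot (n u) (n u) = 1)
  (nx : forall u i, U u -> dot (n u) (partial i x u) = 0).
Hypothesis hW : forall u, U u -> exists W : 'M[R]_2,
  [/\ \det W != 0, 'J n u = W *m 'J x u, row_free ('J n u) &
   dot (x u) (n u) * \tr W =
     (dot (x u) (x u) + dot (x u) (n u) ^+ 2) * \det W].

Let psi u := dot (x u) (n u).

Lemma support_continuous u : U u -> {for u, continuous psi}.
Proof.
by move=> Uu; apply: (cvg_dot (F := nbhs u)); exact: smooth_continuous Uu.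
Qed.

(* Near a maximum point of [psi ^+ 2], the barrier with pole at [n u1] excludes
   the value [psi u1 ^+ 2 < m]. *)
Lemma support_strong_maximum (m : R) u0 : 0 < m -> U u0 ->
  (forall u, U u -> psi u ^+ 2 <= m) -> psi u0 ^+ 2 = m ->
  \forall u \near u0, psi u ^+ 2 = m.
Proof.
move=> m0 Uu0 psim psi0.
have [W0 [_ _ rf0 _]] := hW Uu0.
have [rho [C [rho0 C0 rhoU expand]]] := smooth_expanding oU sn Uu0 rf0.
have expand2 u v : ball u0 rho u -> ball u0 rho v ->
    `|u - v| ^+ 2 <= C * (2 * (1 - dot (n u) (n v))).
  by move=> bu bv; rewrite -unit_distE ?expand //; apply: n1; exact: rhoU.
have bu0 : ball u0 rho u0 by exact: ballxx.
pose r := rho / 2.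
have r0 : 0 < r by rewrite divr_gt0.
have near1 : \forall u1 \near u0, `|u0 - u1| < r / 2.
  by apply/nbhs_ballP; exists (r / 2) => /=; rewrite ?divr_gt0 // -ball_normE.
(* This makes [1 - dot n (n u1)] smaller at [u0] than on the outer boundary of [K] below, whose
   points lie at distance at least [r / 2] from [u1]. *)
have near2 : \forall u1 \near u0, C * (2 * (1 - dot (n u0) (n u1))) < (r / 2) ^+ 2.
  have c1 : dot (n u0) (n u1) @[u1 --> u0] --> dot (n u0) (n u0).
    apply: (cvg_dot (F := nbhs u0)); first exact: cvg_cst.
    exact: smooth_continuous Uu0.
  have c2 : C * (2 * (1 - dot (n u0) (n u1))) @[u1 --> u0]
      --> C * (2 * (1 - dot (n u0) (n u0))).
    exact: cvgMl_tmp (cvgMl_tmp (cvgB (cvg_cst _) c1)).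
  rewrite (n1 Uu0) subrr !mulr0 in c2.
  have r2 : 0 < (r / 2) ^+ 2 by rewrite exprn_gt0 // divr_gt0.
  by move/cvgr_lt : c2 => /(_ _ r2).
apply: filterS2 near1 near2 => u1 u1r u1s.
have bu1 : ball u0 rho u1 by rewrite -ball_normE /=; move: u1r; rewrite /r; lra.
have Uu1 := rhoU _ bu1.
apply/eqP; rewrite eq_le psim //= leNgt; apply/negP => psi1.
pose a := n u1; pose s u := 1 - dot (n u) a.
have a1 : dot a a = 1 by exact: n1.
(* Any value strictly between [psi u1 ^+ 2] and [m] would do: it bounds [psi ^+ 2] on a whole ball
   around the pole. *)
pose m' := (m + psi u1 ^+ 2) / 2.
have m'0 : 0 <= m' by have := sqr_ge0 (psi u1); rewrite /m'; lra.
have m'm : m' < m by rewrite /m'; lra.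
have [d d0 hd] : exists2 d : R, 0 < d &
    forall u, `|u - u1| <= d -> psi u ^+ 2 <= m'.
  have : psi u ^+ 2 @[u --> u1] --> psi u1 ^+ 2.
    exact: (cvgM (support_continuous Uu1) (support_continuous Uu1)).
  have e0 : 0 < m' - psi u1 ^+ 2 by rewrite /m'; lra.
  move/cvgrPdist_lt => /(_ _ e0) /nbhs_ballP [d /= d0 hd].
  exists (d / 2); first by rewrite divr_gt0.
  move=> u ud; have : ball u1 d u by rewrite -ball_normE /= distrC; lra.
  by move/hd => /=; rewrite ltr_norml => /andP[h _]; lra.
(* A closed ball around [u0] with an open ball around the pole [u1] removed. *)
pose K := [set u : 'rV[R]_2 | `|u - u0| <= r /\ d <= `|u - u1|].
have Kball u : K u -> ball u0 rho u.
  by move=> [ur _]; rewrite -ball_normE /= distrC; move: ur; rewrite /r; lra.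
have sK u : K u -> d ^+ 2 <= C * (2 * s u).
  move=> Ku; apply: le_trans (expand2 _ _ (Kball _ Ku) bu1).
  have [_ du] := Ku; rewrite lerXn2r // nnegrE ?normr_ge0 //.
  exact: ltW.
have s_gt0 u : K u -> 0 < s u.
  move=> /sK /(lt_le_trans _) h; have := h 0; rewrite exprn_gt0 // => /(_ isT).
  by rewrite pmulr_rgt0 // pmulr_rgt0.
have Ku0 : K u0.
  split; first by rewrite subrr normr0 ltW.
  by rewrite leNgt; apply/negP => /ltW /hd; rewrite psi0 leNgt m'm.
have s0 := s_gt0 _ Ku0.
have compK : compact K.
  apply: bounded_closed_compact.
    exists (`|u0| + r); split; first exact: num_real.
    move=> M hM u [ur _]; apply: ltW; apply: le_lt_trans hM.
    have := ler_normD (u - u0) u0; rewrite subrK; lra.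
  have cn v : continuous (fun u : 'rV[R]_2 => `|u - v|).
    by move=> u; exact: cvg_norm (cvgB cvg_id (cvg_cst _)).
  apply: closedI.
    by apply: (closed_comp _ (@closed_le R r)) => u _; exact: cn.
  by apply: (closed_comp _ (@closed_ge R d)) => u _; exact: cn.
(* Since [m' / m < 1], a large exponent makes the quotient [q] below smaller on the inner boundary
   of [K] than at [u0]. *)
have [k hk] : exists k, m' ^+ k.+1 * (C * 2) / d ^+ 2 < m ^+ k.+1 / s u0.
  have e0 : 0 < d ^+ 2 / (C * 2 * s u0) by rewrite divr_gt0 ?exprn_gt0 // !mulr_gt0.
  have [||k hk] := expr_lt_eps _ _ e0 (z := m' / m).
  - by rewrite divr_ge0 // ltW.
  - by rewrite ltr_pdivrMr // mul1r.
  exists k; move: hk; rewrite expr_div_n.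
  rewrite ltr_pdivrMr ?exprn_gt0 // => hk.
  rewrite ltr_pdivrMr ?exprn_gt0 // mulrAC ltr_pdivlMr //.
  rewrite -mulrA -ltr_pdivlMr ?mulr_gt0 //.
  by apply: lt_le_trans hk _; rewrite mulrC mulrA.
pose q u := psi u ^+ (2 * k.+1) / s u.
have psiE u : psi u ^+ (2 * k.+1) = (psi u ^+ 2) ^+ k.+1 by rewrite exprM.
have cq : {within K, continuous q}.
  apply: continuous_in_subspaceT => u /set_mem Ku.
  have Uu := rhoU _ (Kball _ Ku).
  have c1 : psi v ^+ (2 * k.+1) @[v --> u] --> psi u ^+ (2 * k.+1).
    have h := @exprn_continuous R (2 * k.+1) (psi u).
    exact: (@continuous_cvg _ _ _ _ _ psi _ _ h (support_continuous Uu)).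
  have c2 : dot (n v) a @[v --> u] --> dot (n u) a.
    by apply: (cvg_dot (F := nbhs u)); [exact: smooth_continuous Uu|exact: cvg_cst].
  have c3 : s v @[v --> u] --> s u by exact: cvgB (cvg_cst _) c2.
  exact: cvgM c1 (cvgV (lt0r_neq0 (s_gt0 _ Ku)) c3).
have [u /set_mem Ku qmax] := EVT_max_rV (ex_intro _ u0 Ku0) compK cq.
have su := s_gt0 _ Ku.
have Uu := rhoU _ (Kball _ Ku).
have q0 : m ^+ k.+1 / s u0 <= q u.
  by have := qmax u0 (mem_set Ku0); rewrite {1}/q psiE psi0.
have qu0 : 0 < q u by apply: lt_le_trans q0; rewrite divr_gt0 // exprn_gt0.
(* On the outer boundary the numerator is at most its value at [u0] and the denominator is strictly
   larger. *)
have ur : `|u - u0| < r.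
  rewrite lt_neqAle; case: (Ku) => -> _; rewrite andbT; apply/eqP => ur.
  have : s u0 < s u.
    have h1 : (r / 2) ^+ 2 <= C * (2 * s u).
      apply: le_trans (expand2 _ _ (Kball _ Ku) bu1).
      rewrite lerXn2r ?nnegrE ?divr_ge0 // ?ltW //.
      by have := ler_distD u1 u u0; rewrite ur (distrC u1); lra.
    have : C * (2 * s u0) < C * (2 * s u) by apply: lt_le_trans h1.
    by rewrite ltr_pM2l // ltr_pM2l.
  move=> ss; move: q0; rewrite leNgt => /negP; apply.
  rewrite /q psiE; apply: le_lt_trans (_ : m ^+ k.+1 / s u < _).
    by rewrite ler_pM2r ?invr_gt0 // lerXn2r ?nnegrE ?sqr_ge0 ?psim // ltW.
  by rewrite ltr_pM2l ?exprn_gt0 // ltf_pV2.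
(* The inner boundary is excluded by the choice of [k]. *)
have ud : d < `|u - u1|.
  rewrite ltNge; apply/negP => /hd hm; move: q0; rewrite leNgt => /negP; apply.
  apply: le_lt_trans hk; rewrite /q psiE ler_pdivrMr //.
  apply: le_trans (_ : m' ^+ k.+1 <= _).
    by rewrite lerXn2r ?nnegrE ?sqr_ge0.
  have -> : m' ^+ k.+1 * (C * 2) / d ^+ 2 * s u =
    m' ^+ k.+1 * (C * (2 * s u) / d ^+ 2) by ring.
  by rewrite ler_peMr ?exprn_ge0 // ler_pdivlMr ?exprn_gt0 // mul1r sK.
have Kn : \forall v \near u, K v.
  have cn w : `|v - w| @[v --> u] --> `|u - w|.
    by exact: cvg_norm (cvgB cvg_id (cvg_cst _)).
  have /cvgr_lt /(_ _ ur) h1 := cn u0; have /cvgr_gt /(_ _ ud) h2 := cn u1.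
  by apply: filterS2 h1 h2 => v v1 v2; split; exact: ltW.
have [W [W1 JW rf ss]] := hW Uu.
have [e1 [e2 [h1 h2 h12]]] := orthonormal_frame rf.
have tr := frame_trace W1 JW h1 h2 h12.
apply: (@no_barrier_maximum R U x n oU sx sn n1 nx k (q u) a u e1 e2 Uu qu0 a1 su).
- by rewrite (smooth_deriveE sn).
- by rewrite (smooth_deriveE sn).
- by rewrite !(smooth_deriveE sn).
- rewrite !(smooth_deriveE sn) // !(smooth_deriveE sx) //.
  by apply: (mulIf W1); rewrite -mulrA tr.
- by rewrite /q divfK // gt_eqF.
apply: filterS Kn => v Kv; have := qmax v (mem_set Kv).
by rewrite {1}/q ler_pdivrMr // s_gt0.
Qed.

End StrongMaximum.

(** * Local parametrizations and the Weingarten equation *)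

Section Chart.
Variables (R : realType) (S : set 'rV[R]_3) (N : 'rV[R]_3 -> 'rV[R]_3)
  (U : set 'rV[R]_2) (X : 'rV[R]_2 -> 'rV[R]_3).
Hypothesis lpX : local_param S U X.

Lemma local_param_sub u : U u -> S (X u).
Proof.
move=> Uu; have [V _ E] := lp_image lpX.
by have [] : (V `&` S) (X u) by rewrite -E; exists u.
Qed.

(** Transfers local statements from the parameter plane to the surface: the inverse [Y] is
    continuous on the image, and the image is relatively open. *)
Lemma local_param_near (P : set 'rV[R]_3) u : U u ->
  (\forall v \near u, P (X v)) ->
  \forall p \near X u, S p -> P p.
Proof.
move=> Uu PX; have [V oV XUV] := lp_image lpX.
have [Y YX cY] := lp_inverse lpX.
have XUu : (X @` U) (X u) by exists u.
have /subspace_continuousP /(_ _ XUu) := cY => cYu.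
have PY : nbhs (Y (X u)) [set v | P (X v)] by rewrite (YX _ Uu).
have Vu : V (X u) by move: XUu; rewrite XUV => -[].
have h1 : \forall p \near X u, V p by exact: open_nbhs_nbhs.
have h2 : \forall p \near X u, (X @` U) p -> P (X (Y p)) by exact: cYu _ PY.
apply: filterS2 h1 h2 => p Vp h Sp.
have XUp : (X @` U) p by rewrite XUV.
by have := h XUp; case: XUp => w Uw <-; rewrite YX.
Qed.

Lemma local_param_not_constant u p : U u -> ~ (forall v, U v -> X v = p).
Proof.
move=> Uu Xp; have sX := lp_smooth lpX.
have D0 (e : 'rV[R]_2) : e *m 'J X u = 0.
  rewrite -(smooth_deriveE sX) // -[RHS](derive_cst p u e).
  apply: near_eq_derive; near=> v; apply: Xp; near: v.
  exact: open_nbhs_nbhs (conj (lp_open lpX) Uu).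
have := D0 (delta_mx 0 0) => /eqP; rewrite mulmx_free_eq0 ?(lp_immersion lpX) //.
by move=> /eqP /rowP /(_ 0) /eqP; rewrite !mxE oner_eq0.
Unshelve. all: by end_near. Qed.

Hypothesis nN : unit_normal S N.

Lemma unit_normal_partial u i : U u -> dot (N (X u)) (partial i X u) = 0.
Proof. by move=> Uu; have [_ /(_ u Uu) [_]] := nN lpX. Qed.

Lemma unit_normal_smooth : smooth_on U (N \o X).
Proof. by have [] := nN lpX. Qed.

Lemma unit_normal_unit u : U u -> dot (N (X u)) (N (X u)) = 1.
Proof. by move=> Uu; have [_ /(_ u Uu) []] := nN lpX. Qed.

(** As [N] has unit length its derivatives are tangent, so a matrix with this property exists and
    [xget] returns one rather than its default 0. *)
Lemma jacobian_weingarten u : U u ->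
  'J (N \o X) u = weingarten N X u *m 'J X u.
Proof.
move=> Uu; have sX := lp_smooth lpX; have sN := unit_normal_smooth.
have tangent : ('J (N \o X) u <= 'J X u)%MS.
  apply: (tangent_direction (n := N (X u))).
  - exact: (lp_immersion lpX Uu).
  - exact: unit_normal_unit.
  - by move=> i; rewrite -(partial_jacobian sX) // unit_normal_partial.
  - move=> i; rewrite -(partial_jacobian sN) //.
    exact: (dot_normal_derive_normal (lp_open lpX) sN unit_normal_unit).
have rowE (W : 'M[R]_2) : 'J (N \o X) u = W *m 'J X u <->
    forall i, partial i (N \o X) u = \sum_j W i j *: partial j X u.
  have rW i : row i (W *m 'J X u) = \sum_j W i j *: partial j X u.
    rewrite row_mul mulmx_sum_row; apply: eq_bigr => j _.
    by rewrite (partial_jacobian sX) // mxE.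
  split=> [E i|E]; first by rewrite (partial_jacobian sN) // E rW.
  by apply/row_matrixP => i; rewrite rW -E (partial_jacobian sN).
have [W JW] : exists W : 'M[R]_2, 'J (N \o X) u = W *m 'J X u.
  by exists ('J (N \o X) u *m pinvmx ('J X u)); rewrite mulmxKpV.
have h := (rowE W).1 JW; apply/rowE.
exact: (@xgetPex _ 0 [set W : 'M[R]_2 | forall i,
  partial i (N \o X) u = \sum_j W i j *: partial j X u] (ex_intro _ W h)).
Qed.

End Chart.

(** * Consequences of the defining equation of an SS-surface *)

Section SSSurface.
Variables (R : realType) (S : set 'rV[R]_3) (N : 'rV[R]_3 -> 'rV[R]_3).
Hypothesis hSS : SS_surface S N.

Let nN := ss_normal hSS.

Lemma SS_weingarten U X u : local_param S U X -> U u -> exists W : 'M[R]_2,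
  [/\ \det W != 0, 'J (N \o X) u = W *m 'J X u, row_free ('J (N \o X) u) &
   dot (X u) ((N \o X) u) * \tr W =
     (dot (X u) (X u) + dot (X u) ((N \o X) u) ^+ 2) * \det W].
Proof.
move=> lpX Uu; exists (weingarten N X u).
have K0 := ss_curved hSS lpX Uu.
have JE := jacobian_weingarten lpX nN Uu.
split=> //.
  rewrite JE /row_free (eqmxMfull _ _); first exact: (lp_immersion lpX Uu).
  by rewrite row_full_unit unitmxE unitfE.
have := (ss_sphereE (unit_normal_unit lpX nN Uu) K0).1 (ss_sphere hSS lpX Uu).
rewrite /mean_curvature /gauss_curvature /Defs.support /sqdist /=.
set W := weingarten N X u; move: (dot _ _) (dot _ _) (\tr W) (\det W) => a b c d h.
by lra.
Qed.

Lemma local_param_support_maximum m U X u : local_param S U X -> U u -> 0 < m ->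
  (forall v, U v -> Defs.support N (X v) ^+ 2 <= m) ->
  Defs.support N (X u) ^+ 2 = m ->
  \forall v \near u, Defs.support N (X v) ^+ 2 = m.
Proof.
move=> lpX Uu m0 hm um.
exact: (support_strong_maximum (lp_open lpX) (lp_smooth lpX)
  (unit_normal_smooth lpX nN) (unit_normal_unit lpX nN)
  (fun v i Uv => unit_normal_partial lpX nN i Uv)
  (fun v Uv => SS_weingarten lpX Uv) m0 Uu hm um).
Qed.

Lemma support_chart_continuous U X u : local_param S U X -> U u ->
  {for u, continuous (fun v => Defs.support N (X v))}.
Proof.
move=> lpX Uu; apply: (cvg_dot (F := nbhs u)).
  exact: (smooth_continuous (lp_smooth lpX) Uu).
exact: (smooth_continuous (unit_normal_smooth lpX nN) Uu).
Qed.

(** The derivative of the support function is the product of the position with the derivative of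
    [N]. It vanishes, and the derivatives of [N] span the tangent plane since the curvature is
    nonzero; so the position is normal. *)
Lemma constant_support_position m p : (forall q, S q -> Defs.support N q ^+ 2 = m) ->
  S p -> p = Defs.support N p *: N p.
Proof.
move=> hm Sp; have [U [X [lpX [u Uu Xu]]]] := ss_regular hSS Sp.
rewrite -Xu; have oU := lp_open lpX; have sX := lp_smooth lpX.
have sN := unit_normal_smooth lpX nN.
have XS v (Uv : U v) : S (X v) := local_param_sub lpX Uv.
have dpsi e := is_derive_support sX sN
  (fun v i Uv => unit_normal_partial lpX nN i Uv) e Uu.
have D0 e : dot (X u) ('D_e (N \o X) u) = 0.
  (* Differentiating the constant square gives information only where the support function is
     nonzero; if it vanishes here, then [m = 0] and it vanishes everywhere. *)
  have [psi0|psi0] := eqVneq (Defs.support N (X u)) 0.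
    have m0 : m = 0 by rewrite -(hm _ (XS _ Uu)) psi0 expr0n.
    have [_ <-] := dpsi e; rewrite -[RHS](derive_cst (0 : R) u e).
    apply: near_eq_derive; near=> v; apply/eqP.
    have : Defs.support N (X v) ^+ 2 == 0.
      rewrite hm ?m0 //; apply: XS; near: v; exact: open_nbhs_nbhs.
    by rewrite expf_eq0.
  have [_ E] := is_derive_mul (dpsi e) (dpsi e).
  have : 'D_e (fun v => dot (X v) ((N \o X) v) * dot (X v) ((N \o X) v)) u = 0.
    rewrite -[RHS](derive_cst m u e); apply: near_eq_derive; near=> v.
    rewrite -expr2; apply: (hm (X v)); apply: XS; near: v; exact: open_nbhs_nbhs.
  rewrite E => /eqP; rewrite -mulr2n mulrn_eq0 /= mulf_eq0.
  by rewrite (negPf (psi0 : dot (X u) ((N \o X) u) != 0)) => /eqP.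
have [W [_ _ rN _]] := SS_weingarten lpX Uu.
apply: (normal_direction rN) => [||i].
- exact: (unit_normal_unit lpX nN Uu).
- move=> i; rewrite -(partial_jacobian sN) //.
  exact: (dot_normal_derive_normal oU sN (unit_normal_unit lpX nN)).
by rewrite -(partial_jacobian sN) //; exact: D0.
Unshelve. all: by end_near. Qed.

(** At a maximum of the height in direction [q], its first derivatives vanish, so [q] is orthogonal
    to the tangent plane. *)
Lemma maximal_direction p q : S p -> (forall p', S p' -> dot p' q <= dot p q) ->
  q = dot q (N p) *: N p.
Proof.
move=> Sp hq; have [U [X [lpX [u Uu Xu]]]] := ss_regular hSS Sp.
have oU := lp_open lpX; have sX := lp_smooth lpX.
rewrite -Xu; apply: (normal_direction (lp_immersion lpX Uu)) => [||i].
- exact: (unit_normal_unit lpX nN Uu).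
- by move=> i; rewrite -(partial_jacobian sX) // (unit_normal_partial lpX).
rewrite -(partial_jacobian sX) // dotC.
have [|||] // := @second_derivative_test _ _ (fun v => dot (X v) q)
  (fun v => dot (partial i X v) q) u (delta_mx 0 i).
- near=> v; apply: is_derive_dot_cst; apply: (smooth_derivable sX).
  by near: v; exact: open_nbhs_nbhs.
- have := @is_derive_dot_cst _ _ _ (partial i X) q u (delta_mx 0 i).
  by case; first exact: (smooth_derive_derivable oU sX).
- near=> v; rewrite Xu; apply: hq.
  by apply: (local_param_sub lpX); near: v; exact: open_nbhs_nbhs.
Unshelve. all: by end_near. Qed.

Lemma SS_surface_not_singleton p : S p -> exists2 q, S q & q != p.
Proof.
move=> Sp; apply: contrapT => h.
have [U [X [lpX [u Uu Xu]]]] := ss_regular hSS Sp.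
apply: (local_param_not_constant lpX Uu (p := p)) => v Uv.
apply/eqP; apply: contrapT => /negP vp; apply: h; exists (X v) => //.
exact: (local_param_sub lpX Uv).
Qed.

End SSSurface.

(** * Connectedness, and the identification of the surface with a sphere *)

Lemma connected_locally_constant (T : topologicalType) (S P : set T) p :
  connected S -> S p -> P p ->
  (forall q, S q -> P q -> \forall q' \near q, S q' -> P q') ->
  (forall q, S q -> ~ P q -> \forall q' \near q, S q' -> ~ P q') ->
  S `<=` P.
Proof.
move=> cS Sp Pp oP oNP.
suff <- : S `&` P = S by move=> q [].
apply: cS; first by exists p.
- exists (interior [set q | S q -> P q]); first exact: open_interior.
  apply/seteqP; split=> q [Sq h]; split=> //; first exact: oP.
  exact: (nbhs_singleton h).
- exists (~` interior [set q | S q -> ~ P q]).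
    by apply: open_closedC; exact: open_interior.
  apply/seteqP; split=> q [Sq h]; split=> //.
    by move=> /nbhs_singleton /(_ Sq).
  by apply: contrapT => nP; apply: h; exact: oNP.
Qed.

Theorem theorem3p6 (R : realType) (S : set 'rV[R]_3)
    (N : 'rV[R]_3 -> 'rV[R]_3) (hSS : SS_surface S N)
    (hcompact : compact S) (hnonempty : S !=set0) (hconnected : connected S) :
  exists (c : 'rV[R]_3) (r : R), 0 < r /\ S = sphere c r.
Proof.
have nN := ss_normal hSS.
pose f p := Defs.support N p ^+ 2.
have fchart U X u : local_param S U X -> U u ->
    f (X v) @[v --> u] --> f (X u).
  move=> lpX Uu; have h := support_chart_continuous hSS lpX Uu.
  exact: (cvgM h h).
have cf : {within S, continuous f}.
  apply/subspace_continuousP => p Sp.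
  have [U [X [lpX [u Uu <-]]]] := ss_regular hSS Sp.
  move=> B fB; exact: (local_param_near lpX Uu (fchart _ _ _ lpX Uu _ fB)).
have [p0 /set_mem Sp0 fmax] := EVT_max_rV hnonempty hcompact cf.
pose m := f p0.
have fm p : S p -> f p <= m by move=> Sp; apply: fmax; exact: mem_set.
have fE p : S p -> f p = m.
  (* The maximum principle requires a positive maximum; otherwise the square [f] is identically
     0. *)
  have [m0|m0] := leP m 0.
    move=> Sp; apply/eqP; rewrite eq_le fm //.
    by apply: le_trans m0 _; exact: sqr_ge0.
  (* The set where the maximum is attained is relatively open by the strong maximum principle, its
     complement by continuity. *)
  apply: (@connected_locally_constant _ S [set q | f q = m] p0) => //.
  - move=> q Sq fq; have [U [X [lpX [u Uu Xu]]]] := ss_regular hSS Sq.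
    rewrite -Xu; apply: (local_param_near lpX Uu).
    apply: (local_param_support_maximum hSS lpX Uu m0); last by rewrite Xu.
    by move=> v Uv; apply: fm; exact: (local_param_sub lpX Uv).
  - move=> q Sq fq; have [U [X [lpX [u Uu Xu]]]] := ss_regular hSS Sq.
    rewrite -Xu in Sq fq *; apply: (local_param_near lpX Uu).
    have flt : f (X u) < m by rewrite lt_neqAle fm // andbT; exact/eqP.
    have := fchart _ _ _ lpX Uu => /cvgr_lt /(_ _ flt).
    by apply: filterS => v /lt_eqF /eqP.
have posE p (Sp : S p) := constant_support_position hSS fE Sp.
have N1 p : S p -> dot (N p) (N p) = 1.
  move=> Sp; have [U [X [lpX [u Uu <-]]]] := ss_regular hSS Sp.
  exact: (unit_normal_unit lpX nN Uu).
have dE p : S p -> dot p p = m.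
  by move=> Sp; rewrite (posE p Sp) dotZl dotZr N1 // mulr1 -expr2; exact: fE.
(* If [m] were 0, every point of the surface would be the origin. *)
have m0 : 0 < m.
  rewrite lt_neqAle sqr_ge0 andbT; apply/eqP => m0.
  have [q Sq /eqP] := SS_surface_not_singleton hSS Sp0; apply.
  by rewrite (dot_eq0 (etrans (dE _ Sp0) (esym m0)))
    (dot_eq0 (etrans (dE _ Sq) (esym m0))).
exists 0, (Num.sqrt m); split; first by rewrite sqrtr_gt0.
rewrite /sphere sqr_sqrtr ?(ltW m0) //.
apply/seteqP; split=> [p Sp|q] /=; rewrite subr0; first exact: dE.
move=> qm.
have cq : {within S, continuous (fun p => dot p q)}.
  apply: continuous_subspaceT => p; apply: (cvg_dot (F := nbhs p)).
    exact: cvg_id.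
  exact: cvg_cst.
(* For [q] on the sphere, the normal at the highest point [p] in direction [q] is parallel to [q];
   equal lengths then leave [q = p] or [q = - p]. *)
have [p /set_mem Sp pmax] := EVT_max_rV hnonempty hcompact cq.
have pq p' : S p' -> dot p' q <= dot p q by move=> Sp'; apply: pmax; exact: mem_set.
have qE := maximal_direction hSS Sp pq.
have : dot q (N p) ^+ 2 = Defs.support N p ^+ 2.
  by rewrite -/(f p) (fE p Sp) -qm [in RHS]qE dotZl dotZr N1 // mulr1.
move=> /eqP; rewrite eqf_sqr => /orP[] /eqP qN.
  by rewrite qE qN -posE.
have qp : q = - p by rewrite qE qN scaleNr -posE.
(* If [q = - p], maximality gives [dot p' p >= m] for all [p'] in [S], so the squared distance
   [2 * m - 2 * dot p' p] is zero and [S] is a single point. *)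
have [p' Sp' /eqP] := SS_surface_not_singleton hSS Sp; case.
apply/eqP; rewrite -subr_eq0; apply/eqP; apply: dot_eq0; apply/eqP.
rewrite eq_le dot_ge0 andbT.
have := pq _ Sp'; rewrite qp !dotNr (dE _ Sp) dotDl !dotDr !dotNl !dotNr.
by rewrite (dE _ Sp) (dE _ Sp') (dotC p p'); lra.
Qed.
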